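(* Let $n\geqslant 1$ be an integer, $X=\{1,\ldots,n\}$, and let $I$ be a real interval, possibly unbounded, centered at $0$ with $[-1,1]\subseteq I$. Then a function $f\colon I^n\to\mathbb{R}$ is a symmetric signed Choquet integral if and only if the following two conditions hold: (i) $f$ is comonotonically modular. (ii) $f(x\mathbf{1}_S)=x\,f(\mathbf{1}_S)$ for all $x\in I$ and all $S\subseteq X$.
   Context: Notation: an interval $I$ is centered at $0$ if $-x\in I$ for every $x\in I$. $\mathfrak{S}_X$ is the set of permutations of $X=\{1,\ldots,n\}$. For $\sigma\in\mathfrak{S}_X$, $\mathbb{R}^n_\sigma=\{\mathbf{x}=(x_1,\ldots,x_n)\in\mathbb{R}^n : x_{\sigma(1)}\leqslant\cdots\leqslant x_{\sigma(n)}\}$ and $I^n_\sigma=I^n\cap\mathbb{R}^n_\sigma$. For $S\subseteq X$, $\mathbf{1}_S$ is the $n$-tuple whose $i$th component is $1$ if $i\in S$ and $0$ otherwise. For $i\in X$, $S_\sigma^{\uparrow}(i)=\{\sigma(i),\ldots,\sigma(n)\}$, and $S_\sigma^{\uparrow}(n+1)=\varnothing$. For $\mathbf{x}\in\mathbb{R}^n$, $\mathbf{x}^+$ is the $n$-tuple whose $i$th component is $\max(x_i,0)$, and $\mathbf{x}^-=(-\mathbf{x})^+$. Symmetric signed Choquet integral: a signed capacity on $X$ is a set function $v\colon 2^X\to\mathbb{R}$ with $v(\varnothing)=0$. The signed Choquet integral with respect to $v$ is the (well-defined) function $C_v\colon\mathbb{R}^n\to\mathbb{R}$ given by $$C_v(\mathbf{x})=\sum_{i=1}^n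 x_{\sigma(i)}\big(v(S_\sigma^{\uparrow}(i))-v(S_\sigma^{\uparrow}(i+1))\big),\qquad \mathbf{x}\in\mathbb{R}^n_\sigma,\ \sigma\in\mathfrak{S}_X.$$ The symmetric signed Choquet integral with respect to $v$ is the function $\check{C}_v\colon\mathbb{R}^n\to\mathbb{R}$ defined by $\check{C}_v(\mathbf{x})=C_v(\mathbf{x}^+)-C_v(\mathbf{x}^-)$. A function $f\colon I^n\to\mathbb{R}$ is said to be a symmetric signed Choquet integral if it is the restriction to $I^n$ of $\check{C}_v$ for some signed capacity $v$ on $X$. Comonotonic modularity: two $n$-tuples $\mathbf{x},\mathbf{x}'\in I^n$ are comonotonic if there exists $\sigma\in\mathfrak{S}_X$ such that $\mathbf{x},\mathbf{x}'\in I^n_\sigma$. A function $f\colon I^n\to\mathbb{R}$ is comonotonically modular if $f(\mathbf{x})+f(\mathbf{x}')=f(\mathbf{x}\wedge\mathbf{x}')+f(\mathbf{x}\vee\mathbf{x}')$ for all comonotonic $\mathbf{x},\mathbf{x}'\in I^n$, where $\wedge$ and $\vee$ are the componentwise minimum and maximum. *)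

(* Defs.v *)
From mathcomp Require Import all_boot all_order all_fingroup all_algebra.
From mathcomp Require Import reals.

Set Implicit Arguments.
Unset Strict Implicit.
Unset Printing Implicit Defensive.

Import Order.TTheory GRing.Theory Num.Theory.
Local Open Scope ring_scope.

(* The index set X = {1, ..., n} is 'I_n, with indices shifted to 0, ..., n-1;
   n-tuples of reals are row vectors.
   A function on I^n is represented by a total function on 'rV[R]_n of which
   only the values on I^n are ever constrained. *)

Section Definitions.
Variables (R : realType) (n : nat).
Implicit Types (x y : 'rV[R]_n) (s : 'S_n) (S : {set 'I_n}) (I : interval R)
  (f : 'rV[R]_n -> R) (v : {set 'I_n} -> R).

Definition sorted_by s x : bool :=
  [forall i : 'I_n, forall j : 'I_n,
     (i <= j)%N ==> (x 0 (s i) <= x 0 (s j))].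

Definition cube I x : bool := [forall i, x 0 i \in I].

Definition indic S : 'rV[R]_n := \row_i (i \in S)%:R.

(* With k counted from 0; upset s n is empty. *)
Definition upset s (k : nat) : {set 'I_n} :=
  [set s j | j : 'I_n & (k <= j)%N].

Definition vpos x : 'rV[R]_n := map_mx (fun t => Num.max t 0) x.
Definition vneg x : 'rV[R]_n := vpos (- x).
Definition vmin x y : 'rV[R]_n := map2_mx Num.min x y.
Definition vmax x y : 'rV[R]_n := map2_mx Num.max x y.

Definition signed_capacity v : Prop := v set0 = 0.

Definition choquet_sum v s x : R :=
  \sum_(i < n) x 0 (s i) * (v (upset s i) - v (upset s i.+1)).

(* The default value is never used and the choice of the permutation is
   irrelevant: see choquetE and sorted_by_ex. *)
Definition choquet v x : R :=
  if [pick s | sorted_by s x] is Some s then choquet_sum v s x else 0.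

Definition sym_choquet v x : R := choquet v (vpos x) - choquet v (vneg x).

Definition is_sym_signed_choquet I f : Prop :=
  exists v, signed_capacity v /\ (forall x, cube I x -> f x = sym_choquet v x).

Definition comonotonic I x y : Prop :=
  exists s, [/\ cube I x, sorted_by s x, cube I y & sorted_by s y].

Definition comonotonically_modular I f : Prop :=
  forall x y, comonotonic I x y -> f x + f y = f (vmin x y) + f (vmax x y).

End Definitions.

Section WellDefined.
Variables (R : realType) (n : nat).
Implicit Types (x : 'rV[R]_n) (s t : 'S_n) (v : {set 'I_n} -> R).

Lemma sorted_by_ex x : exists s, sorted_by s x.
Proof.
pose r (i j : 'I_n) := x 0 i <= x 0 j.
have rt : total r by move=> i j; exact: le_total.
have rtr : transitive r by move=> i j k; exact: le_trans.
pose l := sort r (enum 'I_n).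
have sl : size l = n by rewrite size_sort size_enum_ord.
have ul : uniq l by rewrite sort_uniq enum_uniq.
have inj : injective (fun i : 'I_n => nth i l i).
  move=> i j /eqP; rewrite (set_nth_default i j) ?sl //.
  by rewrite nth_uniq ?sl // => /eqP /val_inj.
exists (perm inj); apply/forallP => i; apply/forallP => j.
apply/implyP => ij; rewrite !permE (set_nth_default i j) ?sl //.
apply: (sorted_leq_nth rtr _ i (sort_sorted rt _)); rewrite ?inE ?sl //.
by move=> k; exact: lexx.
Qed.

Lemma sorted_by_values x s t (i : 'I_n) :
  sorted_by s x -> sorted_by t x -> x 0 (s i) = x 0 (t i).
Proof.
pose l (u : 'S_n) := [seq x 0 (u j) | j <- enum 'I_n].
have sz u : size (l u) = n by rewrite size_map size_enum_ord.
have nthl u (j : 'I_n) : nth 0 (l u) j = x 0 (u j).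
  by rewrite (nth_map j) ?size_enum_ord // nth_ord_enum.
have sl u : sorted_by u x -> sorted <=%R (l u).
  move=> /forallP su; apply/(sortedP 0) => k; rewrite sz => kn.
  rewrite (nthl u (Ordinal (ltnW kn))) (nthl u (Ordinal kn)).
  by have /forallP/(_ (Ordinal kn))/implyP := su (Ordinal (ltnW kn)); apply.
have pl u : perm_eq (l u) [seq x 0 j | j <- enum 'I_n].
  rewrite /l (map_comp (fun j => x 0 j) u); apply: perm_map.
  apply: uniq_perm; rewrite ?(map_inj_uniq perm_inj) ?enum_uniq //.
  move=> j; rewrite mem_enum inE; apply/mapP.
  by exists (u^-1%g j); rewrite ?mem_enum ?permKV.
move=> ss st; rewrite -!nthl; congr nth.
apply: (sorted_eq le_trans le_anti (sl _ ss) (sl _ st)).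
by rewrite (perm_trans (pl s)) // perm_sym.
Qed.

Lemma upset_level x s (i : nat) (j : 'I_n) : i.+1 = j -> sorted_by s x ->
  (forall k : 'I_n, i = k -> x 0 (s k) != x 0 (s j)) ->
  upset s j = [set k | x 0 (s j) <= x 0 k].
Proof.
move=> ij /forallP ss ne.
have le (a b : 'I_n) : (a <= b)%N -> x 0 (s a) <= x 0 (s b).
  by have /forallP/(_ b)/implyP := ss a.
have i_n : (i < n)%N by rewrite ltnW // ij.
apply/setP => k; rewrite inE; apply/imsetP/idP => [[m]|lek].
  by rewrite inE => jm ->; exact: le.
exists (s^-1%g k); rewrite ?permKV // inE leqNgt; apply/negP => lt.
have kle : x 0 (s (s^-1%g k)) <= x 0 (s (Ordinal i_n)).
  by apply: le => /=; rewrite -ltnS ij.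
have /negP := ne (Ordinal i_n) erefl; apply; rewrite eq_le.
rewrite (le (Ordinal i_n) j) /=; last by rewrite -ij.
by rewrite permKV in kle; exact: le_trans lek kle.
Qed.

Lemma choquet_sum_indep v s t x : sorted_by s x -> sorted_by t x ->
  choquet_sum v s x = choquet_sum v t x.
Proof.
move=> ss st.
have xE i := sorted_by_values i ss st.
pose d k := v (upset s k) - v (upset t k).
pose y k := if insub k is Some i then x 0 (s i) else 0.
have yE (i : 'I_n) : y i = x 0 (s i) by rewrite /y valK.
have up0 u : upset u 0 = [set: 'I_n] :> {set 'I_n}.
  apply/setP => k; rewrite inE; apply/imsetP.
  by exists (u^-1%g k); rewrite ?inE ?permKV.
have upn u : upset u n = set0 :> {set 'I_n}.
  apply/setP => k; rewrite inE; apply/imsetP => -[j].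
  by rewrite inE leqNgt ltn_ord.
have dz k : (k.+1 < n)%N -> d k.+1 = 0 \/ y k.+1 = y k.
  move=> kn; have k_n := ltnW kn.
  case: (eqVneq (y k.+1) (y k)) => [|ne]; [by right | left].
  have lvl u : sorted_by u x -> (forall i, x 0 (s i) = x 0 (u i)) ->
      upset u k.+1 = [set j | y k.+1 <= x 0 j].
    move=> su E; rewrite (@upset_level x u k (Ordinal kn)) //.
      by rewrite -E -yE.
    move=> i ki; rewrite -!E -!yE /= eq_sym.
    by rewrite -ki.
  by rewrite /d !lvl // subrr.
have d0 : d 0%N = 0 by rewrite /d !up0 subrr.
have abel m : (m <= n)%N ->
    \sum_(i < m) y i * (d i - d i.+1) = - (y m.-1 * d m).
  elim: m => [_|[|m] IH mn]; first by rewrite big_ord0 d0 mulr0 oppr0.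
    by rewrite big_ord1 d0 sub0r mulrN.
  rewrite big_ord_recr /= IH 1?ltnW //=.
  case: (dz m mn) => ->; last by rewrite [y m * (d _ - _)]mulrBr addKr.
  by rewrite mulr0 oppr0 add0r sub0r mulrN.
apply/eqP; rewrite -subr_eq0 /choquet_sum -sumrB.
rewrite (eq_bigr (fun i : 'I_n => y i * (d i - d i.+1))); last first.
  by move=> i _; rewrite yE -xE -mulrBr /d !opprD !opprK addrACA.
by rewrite abel // /d !upn subrr mulr0 oppr0.
Qed.

Lemma choquetE v s x : sorted_by s x -> choquet v x = choquet_sum v s x.
Proof.
rewrite /choquet; case: pickP => [t st ss|no]; last by rewrite no.
exact: choquet_sum_indep.
Qed.

End WellDefined.

(* Main.v *)
(** Along a fixed ordering s, a symmetric Choquet integral is a sum of functions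
    of one coordinate each, and every function of one variable is modular; this
    gives (i).  Conversely, put v(S) = f(1_S).  Modularity at (x, 0) splits f(x)
    into f(x^+) + f(-x^-).  For a nonnegative y sorted by s, let u_k be y with
    its k smallest entries replaced by 0.  The join of u_(k+1) and y_(s k) 1_(upset k)
    is u_k and their meet is y_(s k) 1_(upset (k+1)), so modularity and (ii) add
    exactly one term of the Choquet sum at each step.  Applying this also to
    x |-> - f(- x) settles the negative part. *)
Require Import Defs.
From mathcomp Require Import all_boot all_order all_fingroup all_algebra.
From mathcomp Require Import reals.

Set Implicit Arguments.
Unset Strict Implicit.
Unset Printing Implicit Defensive.

Import Order.TTheory GRing.Theory Num.Theory.
Local Open Scope ring_scope.

Section SymmetricChoquet.
Variables (R : realType) (n : nat).
Implicit Types (x y : 'rV[R]_n) (s : 'S_n) (S : {set 'I_n}) (I : interval R)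
  (f : 'rV[R]_n -> R) (v : {set 'I_n} -> R).

(** * Orderings and cubes under negation and lattice operations *)

Lemma modular_unary (phi : R -> R) a b :
  phi a + phi b = phi (Num.min a b) + phi (Num.max a b).
Proof. by case: leP => _ //; rewrite addrC. Qed.

Lemma sorted_byP s x :
  reflect (forall i j : 'I_n, (i <= j)%N -> x 0 (s i) <= x 0 (s j))
          (sorted_by s x).
Proof.
apply: (iffP forallP) => [h i j|h i]; first by have /forallP/(_ j)/implyP := h i.
by apply/forallP => j; apply/implyP; exact: h.
Qed.

Lemma mem_upset s k j : (j \in upset s k) = (k <= s^-1%g j)%N.
Proof.
apply/imsetP/idP => [[i]|kj]; first by rewrite inE => ki ->; rewrite permK.
by exists (s^-1%g j); rewrite ?permKV // inE.
Qed.

(** Products of permutations act from left to right, so this is [s] read backwards: it sends [i] to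
    [s (rev_ord i)]. *)
Definition reverse s : 'S_n := (perm rev_ord_inj * s)%g.

Lemma sorted_by_opp s x : sorted_by s x -> sorted_by (reverse s) (- x).
Proof.
move=> /sorted_byP ss; apply/sorted_byP => i j ij.
by rewrite !mxE !permM !permE lerN2; apply: ss; rewrite leq_sub2l.
Qed.

Lemma sorted_by_vpos s x : sorted_by s x -> sorted_by s (vpos x).
Proof.
move=> /sorted_byP ss; apply/sorted_byP => i j ij.
by rewrite !mxE le_max2 ?ss.
Qed.

Lemma sorted_by_vmin s x y :
  sorted_by s x -> sorted_by s y -> sorted_by s (vmin x y).
Proof.
move=> /sorted_byP sx /sorted_byP sy; apply/sorted_byP => i j ij.
by rewrite !mxE le_min2 ?sx ?sy.
Qed.

Lemma sorted_by_vmax s x y :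
  sorted_by s x -> sorted_by s y -> sorted_by s (vmax x y).
Proof.
move=> /sorted_byP sx /sorted_byP sy; apply/sorted_byP => i j ij.
by rewrite !mxE le_max2 ?sx ?sy.
Qed.

Lemma sorted_by_scale_upset s k (a : R) :
  0 <= a -> sorted_by s (a *: indic R (upset s k)).
Proof.
move=> a0; apply/sorted_byP => i j ij; rewrite !mxE !mem_upset !permK.
apply: ler_wpM2l => //; case: leqP => // ki.
by rewrite (leq_trans ki ij).
Qed.

Lemma cube_vmin I x y : cube I x -> cube I y -> cube I (vmin x y).
Proof.
move=> /forallP cx /forallP cy; apply/forallP => i.
by rewrite mxE; case: leP.
Qed.

Lemma cube_vmax I x y : cube I x -> cube I y -> cube I (vmax x y).
Proof.
move=> /forallP cx /forallP cy; apply/forallP => i.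
by rewrite mxE; case: leP.
Qed.

Lemma cube_scale_indic I S a :
  0 \in I -> a \in I -> cube I (a *: indic R S).
Proof.
move=> I0 Ia; apply/forallP => i; rewrite !mxE.
by case: (i \in S); rewrite ?mulr1 ?mulr0.
Qed.

Lemma cube_opp I x : (forall t : R, t \in I -> - t \in I) ->
  cube I x -> cube I (- x).
Proof.
by move=> IN /forallP cx; apply/forallP => i; rewrite mxE; exact: IN.
Qed.

(** * Properties (i) and (ii) of symmetric Choquet integrals *)

Lemma sym_choquet_modular v I :
  comonotonically_modular I (sym_choquet v).
Proof.
move=> x y [s [_ sx _ sy]].
(* The negative part is sorted by [reverse s], where the coordinate [s i] sits at position
   [rev_ord i]; this lets both sums be indexed by the same [i]. *)
pose phi (i : 'I_n) (t : R) :=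
  Num.max t 0 * (v (upset s i) - v (upset s i.+1))
  - Num.max (- t) 0 * (v (upset (reverse s) (rev_ord i))
                       - v (upset (reverse s) (rev_ord i).+1)).
have symE z : sorted_by s z -> sym_choquet v z = \sum_i phi i (z 0 (s i)).
  move=> sz; rewrite /sym_choquet (choquetE v (sorted_by_vpos sz)).
  rewrite (choquetE v (sorted_by_vpos (sorted_by_opp sz))) /choquet_sum.
  rewrite [X in _ - X](reindex_inj rev_ord_inj) -sumrB.
  by apply: eq_bigr => i _; rewrite !mxE permM permE rev_ordK.
rewrite !symE ?sorted_by_vmin ?sorted_by_vmax // -!big_split /=.
by apply: eq_bigr => i _; rewrite !mxE; exact: modular_unary.
Qed.

(** The positions of the ones of a sorted 0-1 vector are closed upwards, hence form a tail. It
    starts at the least such position, or at [n] when [S] is empty. *)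
Lemma upset_of_sorted_indic s S :
  sorted_by s (indic R S) -> exists2 k, (k <= n)%N & S = upset s k.
Proof.
move=> /sorted_byP ss.
have up (i j : 'I_n) : (i <= j)%N -> s i \in S -> s j \in S.
  move=> /ss; rewrite !mxE => h si; move: h; rewrite si.
  by case: (s j \in S) => //; rewrite ler10.
have [/existsP[i0 i0S]|/existsPn no] := boolP [exists i, s i \in S].
  case: (@arg_minnP _ i0 [pred i | s i \in S] val i0S) => i /= iS imin.
  exists i; first exact: ltnW.
  apply/setP => j; rewrite mem_upset; apply/idP/idP => [jS|ij].
    by apply: imin; rewrite permKV.
  by rewrite -(permKV s j); exact: up iS.
exists n => //; apply/setP => j; rewrite mem_upset leqNgt ltn_ord.
by rewrite -(permKV s j); apply/negbTE/no.
Qed.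

(** As [a] is nonnegative, an ordering of the indicator also sorts its multiple. The terms below the
    tail [S] vanish and the others telescope to [v S] minus the value at the empty set. *)
Lemma choquet_scale_indic v (a : R) S :
  signed_capacity v -> 0 <= a -> choquet v (a *: indic R S) = a * v S.
Proof.
move=> v0 a0; have [s ss] := sorted_by_ex (indic R S).
have [k kn ->] := upset_of_sorted_indic ss.
rewrite (choquetE v (sorted_by_scale_upset s k a0)) /choquet_sum.
pose F i := v (upset s i).
rewrite (eq_bigr (fun i : 'I_n => if (k <= i)%N then
    a * (F i - F i.+1) else 0)); last first.
  move=> i _; rewrite !mxE mem_upset permK.
  by case: leqP; rewrite ?mulr1 // mulr0 mul0r.
rewrite -big_mkcond /= -(big_geq_mkord k n xpredT (fun i => a * (F i - F i.+1))).
rewrite -mulr_sumr; under eq_bigr do rewrite -opprB.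
rewrite sumrN telescope_sumr // opprB; congr (_ * _).
have -> : F n = v set0.
  by congr v; apply/setP => j; rewrite mem_upset inE leqNgt ltn_ord.
by rewrite v0 subr0.
Qed.

Lemma sym_choquet_scale_indic v a S :
  signed_capacity v -> sym_choquet v (a *: indic R S) = a * v S.
Proof.
move=> v0; have posE t : vpos (t *: indic R S) = Num.max t 0 *: indic R S.
  apply/rowP => i; rewrite !mxE.
  by case: (i \in S); rewrite ?mulr1 ?mulr0 // maxxx.
rewrite /sym_choquet /vneg -scaleNr !posE.
(* It remains to see that the positive part of [a] minus its negative part is [a]. *)
rewrite !choquet_scale_indic ?le_max ?lexx ?orbT // -mulrBl; congr (_ * _).
have [a0|/ltW a0] := leP 0 a; first by rewrite max_r ?oppr_le0 ?subr0.
by rewrite max_l ?oppr_ge0 // opprK add0r.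
Qed.

(** * From (i) and (ii) to the Choquet formula *)

Lemma comonotonically_modular_opp I f :
  (forall t : R, t \in I -> - t \in I) ->
  comonotonically_modular I f ->
  comonotonically_modular I (fun x => - f (- x)).
Proof.
move=> IN fmod x y [s [cx sx cy sy]].
have /fmod : comonotonic I (- x) (- y).
  by exists (reverse s); split; rewrite ?sorted_by_opp ?cube_opp.
have -> : vmin (- x) (- y) = - vmax x y.
  by apply/rowP => i; rewrite !mxE oppr_max.
have -> : vmax (- x) (- y) = - vmin x y.
  by apply/rowP => i; rewrite !mxE oppr_min.
by rewrite -!opprD => ->; rewrite addrC.
Qed.

Lemma choquet_of_modular I f v x :
  0 \in I -> signed_capacity v -> comonotonically_modular I f ->
  (forall a S, a \in I -> f (a *: indic R S) = a * v S) ->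
  cube I x -> (forall i, 0 <= x 0 i) -> f x = choquet v x.
Proof.
move=> I0 v0 fmod fS /forallP cx x0.
have [s ss] := sorted_by_ex x; rewrite (choquetE v ss).
move/sorted_byP: (ss) => xle.
pose u k : 'rV[R]_n := \row_j (if (k <= s^-1%g j)%N then x 0 j else 0).
have cu k : cube I (u k) by apply/forallP => j; rewrite mxE; case: ifP.
(* Zeroing the first entries keeps the order because the remaining ones are nonnegative. *)
have su k : sorted_by s (u k).
  apply/sorted_byP => i j ij; rewrite !mxE !permK.
  case: leqP => [ki|_]; first by rewrite (leq_trans ki ij) xle.
  by case: ifP.
have step (k : 'I_n) : f (u k) = f (u k.+1)
    + x 0 (s k) * (v (upset s k) - v (upset s k.+1)).
  have /fmod : comonotonic I (u k.+1) (x 0 (s k) *: indic R (upset s k)).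
    by exists s; split; rewrite ?cube_scale_indic ?sorted_by_scale_upset.
  have -> : vmin (u k.+1) (x 0 (s k) *: indic R (upset s k))
            = x 0 (s k) *: indic R (upset s k.+1).
    (* The position of [j] is compared with [k]: above [k], the entry of [x] is at least
       [x 0 (s k)]; below, both vectors vanish; at [k], [u k.+1] is 0. *)
    apply/rowP => j; rewrite !mxE !mem_upset; case: ltngtP => [kj|jk|kj].
    - by rewrite mulr1 min_r // -(permKV s j) xle // ltnW.
    - by rewrite mulr0 minxx.
    - by rewrite mulr1 mulr0 min_l.
  have -> : vmax (u k.+1) (x 0 (s k) *: indic R (upset s k)) = u k.
    apply/rowP => j; rewrite !mxE !mem_upset; case: ltngtP => [kj|jk|kj].
    - by rewrite mulr1 max_l // -(permKV s j) xle // ltnW.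
    - by rewrite mulr0 maxxx.
    - by rewrite mulr1 max_r // (val_inj kj) permKV.
  by rewrite !fS // mulrBr addrA => ->; rewrite addrAC subrr add0r.
(* Here [m] counts the top entries kept, so the induction starts at [u n], the zero vector, and ends
   at [u 0], which is [x]. *)
have uE m : (m <= n)%N -> f (u (n - m)%N) = \sum_(i < n | (n - m <= i)%N)
    x 0 (s i) * (v (upset s i) - v (upset s i.+1)).
  elim: m => [_|m IH mn].
    rewrite subn0 big1 => [|i]; last by rewrite leqNgt ltn_ord.
    have -> : u n = 0 *: indic R set0.
      by apply/rowP => j; rewrite !mxE leqNgt ltn_ord mul0r.
    by rewrite fS // mul0r.
  have kn : (n - m.+1 < n)%N by rewrite ltn_subrL; case: (n) mn.
  rewrite (step (Ordinal kn)) /= subnSK // IH 1?ltnW //.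
  rewrite [RHS](bigD1 (Ordinal kn)) //= addrC subnSK //; congr (_ + _).
  apply: eq_bigl => i; rewrite -(subnSK mn) ltn_neqAle andbC.
  by rewrite -val_eqE eq_sym.
have xu : u (n - n)%N = x by apply/rowP => j; rewrite mxE subnn.
by rewrite -{1}xu uE // subnn.
Qed.

Lemma sym_choquet_of_modular I f v x :
  (forall t : R, t \in I -> - t \in I) ->
  0 \in I -> signed_capacity v -> comonotonically_modular I f ->
  (forall a S, a \in I -> f (a *: indic R S) = a * v S) ->
  cube I x -> f x = sym_choquet v x.
Proof.
move=> IN I0 v0 fmod fS cx.
have c0 : cube I (0 : 'rV[R]_n) by apply/forallP => i; rewrite mxE.
have posE y : vpos y = vmax y 0 by apply/rowP => i; rewrite !mxE.
have f0 : f 0 = 0 by rewrite -(scale0r (indic R set0)) fS // mul0r.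
have pos0 y i : 0 <= vpos y 0 i by rewrite mxE le_max lexx orbT.
have cpos y : cube I y -> cube I (vpos y).
  by move=> cy; rewrite posE cube_vmax.
have /fmod : comonotonic I x 0.
  have [s sx] := sorted_by_ex x; exists s; split=> //.
  by apply/sorted_byP => i j _; rewrite !mxE.
have -> : vmin x 0 = - vneg x.
  by apply/rowP => i; rewrite !mxE oppr_max opprK oppr0.
rewrite f0 addr0 -posE => ->; rewrite addrC /sym_choquet.
rewrite (choquet_of_modular I0 v0 fmod fS) ?cpos //; congr (_ + _).
(* The function [fun y => - f (- y)] takes the same value [a * v S] at multiples of indicators, so
   the nonnegative case applies to it at [vneg x] with the same [v]. *)
apply: (canRL (@opprK _)).
apply: (choquet_of_modular (f := fun y => - f (- y)) I0 v0) => //.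
- exact: comonotonically_modular_opp.
- by move=> a S Ia; rewrite -scaleNr fS ?IN // mulNr opprK.
- by apply: cpos; exact: cube_opp.
- by move=> i; exact: pos0.
Qed.

End SymmetricChoquet.

Theorem theorem11 (R : realType) (n : nat) (n_ge1 : (1 <= n)%N)
    (I : interval R)
    (I_centered : forall x : R, x \in I -> - x \in I)
    (I_contains : forall x : R, -1 <= x <= 1 -> x \in I)
    (f : 'rV[R]_n -> R) :
  is_sym_signed_choquet I f <->
  comonotonically_modular I f /\
  (forall (x : R) (S : {set 'I_n}),
     x \in I -> f (x *: indic R S) = x * f (indic R S)).
Proof.
have I0 : 0 \in I by apply: I_contains; rewrite lerN10 ler01.
have I1 : 1 \in I by apply: I_contains; rewrite lexx (le_trans (lerN10 R) ler01).
split=> [[v [v0 fE]]|[fmod fS]].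
  split=> [x y xy|x S Ix].
    case: (xy) => s [cx _ cy _].
    (* The formula for [f] is known only on the cube, which is closed under meet and join. *)
    by rewrite !fE ?cube_vmin ?cube_vmax //; exact: sym_choquet_modular xy.
  rewrite -[in RHS](scale1r (indic R S)) !fE ?cube_scale_indic //.
  by rewrite !sym_choquet_scale_indic // mul1r.
have v0 : signed_capacity (fun S => f (indic R S)).
  (* The indicator of the empty set is 0 times itself, so (ii) with factor 0 makes [f] vanish
     there. *)
  rewrite /signed_capacity; have -> : indic R set0 = 0 *: indic R set0 :> 'rV_n.
    by apply/rowP => i; rewrite !mxE inE mul0r.
  by rewrite fS // mul0r.
by exists (fun S => f (indic R S)); split=> // x; exact: sym_choquet_of_modular.
Qed.
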